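(* Let $\mathcal{R}$ be a mixed voting rule one of whose constituent rules is $\mathrm{MES}^{\mathrm{Value\text{-}Based}}$, and consider any execution of $\mathcal{R}$ on an instance $I=(B,P,A,c)$ in which this constituent rule has available budget share $\alpha$ and minimum voter budget share $\alpha^{\mathrm{Value\text{-}Based}}\ge\alpha$. Then the outcome of $\mathcal{R}$ satisfies $\alpha^{\mathrm{Value\text{-}Based}}$-budget EJR+ up to any project.
   Context: Instances. An instance $I=(B,P,A,c)$ consists of a budget $B\in\mathbb{R}_{>0}$, a finite set $P$ of projects, an approval profile $A=(A_1,\dots,A_n)$ of voters $N=\{1,\dots,n\}$ with $A_i\subseteq P$, and costs $c:P\to\mathbb{R}_{>0}$. Write $c(P')=\sum_{p\in P'}c(p)$ and $N_p=\{i\in N: p\in A_i\}$; it is assumed that $N_p\ne\emptyset$ for all $p\in P$. Voting rules. A voting rule $R$ takes an instance $I$, a rule budget $0<B_R\le B$, and a set $P_0\subseteq P$ of pre-selected projects with $c(P_0)\le B_R$, and outputs a set $R(I,B_R,P_0)=P^*$ with $P_0\subseteq P^*\subseteq P$ and $c(P^* )\le B_R$. Mixed rules. A mixed voting rule $\mathcal{R}=[R_1,\dots,R_m]$ takes an instance $I$, rule budgets $0<B_1\le\dots\le B_m\le B$, and a set $P_0\subseteq P$ with $c(P_0)\le B_1$. It computes $P_k=R_k(I,B_k,P_{k-1})$ for $k=1,\dots,m$, and its outcome is $P_m$. The available budget share of $R_k$ in this execution is $\alpha=(B_k-c(P_{k-1}))/B$; the set of pre-selected projects for $R_k$ is $P_{k-1}$.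 $\mathrm{MES}^M$ (Method of Equal Shares with pre-allocation method $M$). Given rule budget $B_{\mathrm{MES}}$ and pre-selected set $P_0$, let $\alpha=(B_{\mathrm{MES}}-c(P_0))/B$. (1) $M$ determines voter payments $\pi_i\ge 0$ $(i\in N)$ with $\sum_i\pi_i\le c(P_0)$. (2) Rebalancing step: voter budgets $(b_i)_{i\in N}$ are chosen to maximize $\min_{i\in N}(\pi_i+b_i)$ subject to $\sum_i b_i=\alpha B$ and $b_i\ge0$. (3) Starting from the selected set $P_0$, repeat: for each unselected project $p$ with $\sum_{i\in N_p}b_i\ge c(p)$ let $\rho(p)$ be the smallest number with $\sum_{i\in N_p}\min(b_i,\rho(p)c(p))=c(p)$; add to the selected set a project $p$ with minimum $\rho(p)$ (ties broken arbitrarily) and replace $b_i$ by $b_i-\min(b_i,\rho(p)c(p))$ for $i\in N_p$. Stop when $\sum_{i\in N_p}b_i<c(p)$ for every unselected $p$; the selected set is the outcome. Minimum voter budget share. $\alpha^M=\min_{i\in N}(\pi_i+b_i)\frac nB$, where $(\pi_i),(b_i)$ are the payments and budgets from steps (1) and (2). Value-Based pre-allocation. Let $v(p)=|N_p|$. For $p\in P\setminus P_0$ let $U(p)=\{p'\in P_0: v(p')\ge v(p)\}$. The threshold value is $v^*=\max\{v(p): p\in P\setminus P_0,\ c(U(p))+c(p)\le B_{\mathrm{MES}}\}$, with $v^*=0$ if no such $p$ exists. The payments are $\pi_i=\sum_{p\in A_i\cap P_0}\frac{c(p)}{\max\{v(p),v^*\}}$. Axiom. For $\beta\ge0$, a set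 $P^*\subseteq P$ satisfies $\beta$-budget EJR+ up to any project (for $I$) if for every nonempty $N'\subseteq N$ and every $p\in\bigcap_{i\in N'}A_i\setminus P^*$ there is $i\in N'$ with $c(A_i\cap P^* )+c(p)>\beta\frac{|N'|B}{n}$. *)

(* Defs.v *)
From mathcomp Require Import all_boot all_order all_algebra.
From mathcomp Require Import reals.
Set Implicit Arguments.
Unset Strict Implicit.
Unset Printing Implicit Defensive.
Import Order.TTheory GRing.Theory Num.Theory.
Local Open Scope ring_scope.

(* The voter set is nonempty: the rules below take minima over voters. *)
Record instance (R : realType) := Instance {
  budget : R;
  project : finType;
  nvoters : nat;
  approval : 'I_nvoters -> {set project};
  cost : project -> R;
  budget_gt0 : 0 < budget;
  nvoters_gt0 : (0 < nvoters)%N;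
  cost_gt0 : forall p, 0 < cost p;
  approved : forall p, exists i, p \in approval i
}.

Section Instance.
Variables (R : realType) (I : instance R).
Local Notation voter := 'I_(nvoters I).
Local Notation B := (budget I).
Local Notation n := (nvoters I)%:R.

Definition total_cost (S : {set project I}) : R := \sum_(p in S) cost p.

Definition supporters (p : project I) : {set voter} := [set i | p \in approval i].

Definition voter_min (f : voter -> R) : R :=
  \big[Num.min/f (Ordinal (nvoters_gt0 I))]_(i < nvoters I) f i.

Definition admissible (BR : R) (P0 : {set project I}) : Prop :=
  [/\ 0 < BR, BR <= B & total_cost P0 <= BR].

Definition available_share (BR : R) (P0 : {set project I}) : R :=
  (BR - total_cost P0) / B.

Definition ejr_plus_any (beta : R) (S : {set project I}) : Prop :=
  forall (N' : {set voter}) (p : project I),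
    N' != set0 -> p \in (\bigcap_(i in N') approval i) :\: S ->
    exists2 i, i \in N' &
      beta * (#|N'|%:R * B / n) < total_cost (approval i :&: S) + cost p.

End Instance.

(* [outcome I BR P0 S] reads "S is a possible output of the rule"; a relation
   rather than a function, because of arbitrary tie-breaking. *)
Record voting_rule (R : realType) := VotingRule {
  outcome : forall I : instance R,
    R -> {set project I} -> {set project I} -> Prop;
  outcome_sound : forall (I : instance R) (BR : R) (P0 S : {set project I}),
    admissible BR P0 -> outcome BR P0 S ->
    P0 \subset S /\ total_cost S <= BR
}.

(* The rules and rule budgets 1..m are indexed by 'I_m, from 0; Ps k is the
   set pre-selected for rule number k, so the result is Ps m. Values of Ps
   beyond m are irrelevant. *)
Record mixed_execution (R : realType) (m : nat) (Rs : 'I_m -> voting_rule R)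
    (I : instance R) (Bs : 'I_m -> R) (Ps : nat -> {set project I}) : Prop :=
  MixedExecution {
    rule_budget_gt0 : forall k, 0 < Bs k;
    rule_budget_mono : forall j k : 'I_m, (j <= k)%N -> Bs j <= Bs k;
    rule_budget_le : forall k, Bs k <= budget I;
    initial_cost_le : forall k : 'I_m, k = 0%N :> nat ->
      total_cost (Ps 0%N) <= Bs k;
    rule_step : forall k : 'I_m, outcome (Rs k) (Bs k) (Ps k) (Ps k.+1)
  }.

Record preallocation (R : realType) := Preallocation {
  payment : forall I : instance R,
    R -> {set project I} -> 'I_(nvoters I) -> R;
  payment_ge0 : forall (I : instance R) (BR : R) (P0 : {set project I}) i,
    admissible BR P0 -> 0 <= payment BR P0 i;
  payment_sum_le : forall (I : instance R) (BR : R) (P0 : {set project I}),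
    admissible BR P0 ->
    \sum_(i < nvoters I) payment BR P0 i <= total_cost P0
}.

Section MES.
Variables (R : realType) (I : instance R).
Local Notation voter := 'I_(nvoters I).
Local Notation B := (budget I).
Implicit Types (b pi : voter -> R) (S : {set project I}) (p q : project I).

Definition feasible_budgets (alpha : R) b : Prop :=
  (forall i, 0 <= b i) /\ \sum_i b i = alpha * B.

Definition rebalanced (alpha : R) pi b : Prop :=
  feasible_budgets alpha b /\
  forall b', feasible_budgets alpha b' ->
    voter_min (fun i => pi i + b' i) <= voter_min (fun i => pi i + b i).

Definition affordable b p : Prop := cost p <= \sum_(i in supporters p) b i.

Definition covers b p (r : R) : Prop :=
  \sum_(i in supporters p) Num.min (b i) (r * cost p) = cost p.

Definition is_rho b p (r : R) : Prop :=
  covers b p r /\ forall r', covers b p r' -> r <= r'.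

Definition charge b p (r : R) : voter -> R := fun i =>
  if i \in supporters p then b i - Num.min (b i) (r * cost p) else b i.

Inductive mes_run : {set project I} -> (voter -> R) -> {set project I} -> Prop :=
| MesStop S b :
    (forall p, p \notin S -> ~ affordable b p) -> mes_run S b S
| MesBuy S b p r S' :
    p \notin S -> affordable b p -> is_rho b p r ->
    (forall q r', q \notin S -> affordable b q -> is_rho b q r' -> r <= r') ->
    mes_run (p |: S) (charge b p r) S' -> mes_run S b S'.

Lemma mes_run_sound S b S' : (forall i, 0 <= b i) -> mes_run S b S' ->
  S \subset S' /\ total_cost S' <= total_cost S + \sum_i b i.
Proof.
move=> + run; elim: run => {S b S'} [S b _ b0|S b p r S' pS _ [cov _] _ _ IH b0].
  by split => //; rewrite lerDl sumr_ge0.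
have c0 i : 0 <= charge b p r i.
  rewrite /charge; case: ifP => // _.
  by rewrite subr_ge0 ge_min lexx.
have [sub le] := IH c0; split.
  by apply: subset_trans sub; apply: subsetUr.
apply: le_trans le _.
have -> : \sum_i charge b p r i = \sum_i b i - cost p.
  rewrite -cov [in RHS](big_mkcond (fun i => i \in supporters p)) /= -sumrB.
  by apply: eq_bigr => i _; rewrite /charge; case: ifP; rewrite ?subr0.
by rewrite {1}/total_cost big_setU1 //= -/(total_cost S) [leLHS]addrC addrA subrK addrC.
Qed.

End MES.

Section MESRule.
Variables (R : realType) (M : preallocation R).

Definition mes_outcome (I : instance R) (BR : R) (P0 S : {set project I}) : Prop :=
  exists2 b, rebalanced (available_share BR P0) (payment M BR P0) b
           & mes_run P0 b S.

Lemma mes_outcome_sound (I : instance R) (BR : R) (P0 S : {set project I}) :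
  admissible BR P0 -> mes_outcome BR P0 S ->
  P0 \subset S /\ total_cost S <= BR.
Proof.
move=> _ [b [[b0 sb] _]] /(mes_run_sound b0)[-> le]; split => //.
apply: le_trans le _; rewrite sb /available_share divfK ?gt_eqF ?budget_gt0 //.
by rewrite addrC subrK.
Qed.

Definition mes : voting_rule R := VotingRule mes_outcome_sound.

(* The value does not depend on the maximizer b: it is the optimum of the
   rebalancing step. *)
Definition min_voter_budget_share (I : instance R) (BR : R)
    (P0 : {set project I}) (a : R) : Prop :=
  exists2 b, rebalanced (available_share BR P0) (payment M BR P0) b
           & a = voter_min (fun i => payment M BR P0 i + b i)
                 * ((nvoters I)%:R / budget I).

End MESRule.

Section ValueBased.
Variable R : realType.

Definition value (I : instance R) (p : project I) : nat := #|supporters p|.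

Definition at_least_as_valued (I : instance R) (P0 : {set project I})
    (p : project I) : {set project I} :=
  [set p' in P0 | (value p <= value p')%N].

(* An empty \max is 0. *)
Definition threshold (I : instance R) (BR : R) (P0 : {set project I}) : nat :=
  \max_(p in ~: P0 |
        total_cost (at_least_as_valued P0 p) + cost p <= BR) value p.

Definition vb_payment (I : instance R) (BR : R) (P0 : {set project I})
    (i : 'I_(nvoters I)) : R :=
  \sum_(p in approval i :&: P0)
    cost p / (maxn (value p) (threshold BR P0))%:R.

Lemma vb_payment_ge0 (I : instance R) (BR : R) (P0 : {set project I}) i :
  admissible BR P0 -> 0 <= vb_payment BR P0 i.
Proof.
by move=> _; apply: sumr_ge0 => p _; rewrite divr_ge0 ?ler0n // ltW ?cost_gt0.
Qed.

Lemma vb_payment_sum_le (I : instance R) (BR : R) (P0 : {set project I}) :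
  admissible BR P0 ->
  \sum_(i < nvoters I) vb_payment BR P0 i <= total_cost P0.
Proof.
move=> _; rewrite /vb_payment.
rewrite (exchange_big_dep (mem P0)) /=; last by move=> i p _; rewrite inE => /andP[].
apply: ler_sum => p pP0.
rewrite (eq_bigl (mem (supporters p))); last by move=> i; rewrite !inE pP0 andbT.
have [i ip] := approved p.
have v0 : (0 < value p)%N by rewrite card_gt0; apply/set0Pn; exists i; rewrite inE.
rewrite sumr_const -/(value p) -[leLHS]mulr_natr -mulrA.
apply: ler_piMr; first exact/ltW/cost_gt0.
rewrite [leLHS]mulrC ler_pdivrMr ?ltr0n ?leq_max ?v0 //.
by rewrite mul1r ler_nat leq_maxl.
Qed.

Definition value_based : preallocation R :=
  Preallocation vb_payment_ge0 vb_payment_sum_le.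

End ValueBased.

(* Main.v *)
(** Write a := alphaVB * B / n, a lower bound on every pi_i + b_i, and suppose
    (N', p) violates the axiom.  While every voter of N' can pay her share
    c(p)/|N'| of p, MES only buys projects at a rate at most 1/|N'|; as p is never
    bought, some i in N' runs short, so part of pi_i was paid at a rate above
    1/|N'|, which forces v* < |N'| <= v(p).  By the definition of the threshold,
    the projects of P0 valued at least v(p) together with p exceed the rule
    budget.  Averaging the violated inequalities over N' and bounding the
    payments of N' project by project contradicts this, because
    a |N'| <= sum_(i in N') pi_i + (B_MES - c(P0)). *)

From mathcomp Require Import boolp classical_sets.
Require Import Defs.
From mathcomp Require Import all_boot all_order all_algebra.
From mathcomp Require Import reals.
From mathcomp Require Import ring lra.
Import Order.TTheory GRing.Theory Num.Theory.
Local Open Scope ring_scope.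
Set Implicit Arguments.
Unset Strict Implicit.
Unset Printing Implicit Defensive.

(* The solution is the infimum of the superlevel set {r | c <= f r}: the
   Lipschitz bound excludes both f (inf) < c and f (inf) > c. *)
Lemma least_level_of_lipschitz (R : realType) (f : R -> R) (K c l t : R) :
  0 < K -> (forall r s, r <= s -> f s <= f r + (s - r) * K) ->
  (forall r, c <= f r -> l <= r) -> c <= f t ->
  exists2 r, r <= t & f r = c /\ forall s, f s = c -> r <= s.
Proof.
move=> K0 lip low ct.
pose E : set R := fun r => c <= f r.
have lbE : has_lbound E by exists l => r /low.
have hasE : has_inf E by split => //; exists t.
have le_inf r : E r -> inf E <= r by move=> Er; exact: (ge_inf lbE).
exists (inf E); first exact: le_inf.
split; last by move=> s fs; apply: le_inf; rewrite /E fs.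
apply/eqP; rewrite eq_le; apply/andP; split.
  rewrite leNgt; apply/negP => cf.
  pose d := (f (inf E) - c) / K.
  have d0 : 0 < d by rewrite divr_gt0 // subr_gt0.
  have dK : d * K = f (inf E) - c by rewrite divfK // gt_eqF.
  have := lip (inf E - d) (inf E); rewrite subKr dK => /(_ ltac:(lra)) fd.
  by have := le_inf (inf E - d); rewrite /E => /(_ ltac:(lra)); lra.
rewrite leNgt; apply/negP => fc.
pose d := (c - f (inf E)) / K.
have d0 : 0 < d by rewrite divr_gt0 // subr_gt0.
have dK : d * K = c - f (inf E) by rewrite divfK // gt_eqF.
have [r Er rd] := inf_adherent d0 hasE.
have fr := lip _ _ (le_inf _ Er).
have : (r - inf E) * K < d * K by rewrite ltr_pM2r //; lra.
by move: Er; rewrite /E; lra.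
Qed.

(** * Purchase rates in the Method of Equal Shares *)

Section Rules.
Variables (R : realType) (I : instance R).
Implicit Types (b : 'I_(nvoters I) -> R) (S T : {set project I}).
Implicit Types (p q : project I) (V : {set 'I_(nvoters I)}).

Lemma total_cost_subset S T : S \subset T -> total_cost S <= total_cost T.
Proof.
move=> sST; rewrite /total_cost [leRHS](big_setID S) /= (setIidPr sST) lerDl.
by apply: sumr_ge0 => q _; apply/ltW/cost_gt0.
Qed.

Lemma supporters_gt0 p : (0 < #|supporters p|)%N.
Proof.
by have [i ip] := approved p; rewrite card_gt0; apply/set0Pn; exists i; rewrite inE.
Qed.

Lemma charge_ge0 b p r i : (forall j, 0 <= b j) -> 0 <= charge b p r i.
Proof.
move=> b0; rewrite /charge; case: ifP => // _.
by rewrite subr_ge0 ge_min lexx.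
Qed.

Lemma sum_min_lipschitz b p r s : r <= s ->
  \sum_(i in supporters p) Num.min (b i) (s * cost p) <=
  \sum_(i in supporters p) Num.min (b i) (r * cost p) +
  (s - r) * (cost p *+ #|supporters p|).
Proof.
move=> rs; rewrite mulrnAr -sumr_const -big_split /=.
apply: ler_sum => i _.
have d0 : 0 <= (s - r) * cost p by rewrite mulr_ge0 ?subr_ge0 // ltW ?cost_gt0.
rewrite mulrBl in d0 *.
by case: (leP (b i) (s * _)); case: (leP (b i) (r * _)) => //; lra.
Qed.

(** At rate 1/|V| the members of [V] alone already cover [cost p]. Total payment is Lipschitz in the
    rate and nonpositive at negative rates, so a least covering rate exists below 1/|V|. *)
Lemma rho_exists_le b p V :
  V != set0 -> V \subset supporters p -> (forall i, 0 <= b i) ->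
  (forall i, i \in V -> cost p / #|V|%:R <= b i) ->
  exists2 r, r <= #|V|%:R^-1 & is_rho b p r.
Proof.
rewrite -card_gt0 => V0 sV b0 bV; have c0 := cost_gt0 p.
have v0 : (0 : R) < #|V|%:R by rewrite ltr0n.
apply: (@least_level_of_lipschitz _ _ (cost p *+ #|supporters p|) _ 0).
- by rewrite pmulrn_lgt0 // supporters_gt0.
- by move=> r s; apply: sum_min_lipschitz.
- move=> r; apply: contraTT; rewrite -!ltNge => r0; apply: le_lt_trans c0.
  apply: sumr_le0 => i _; rewrite ge_min; apply/orP; right.
  by rewrite pmulr_lle0 ?cost_gt0 // ltW.
rewrite (big_setID V) /= (setIidPr sV).
apply: le_trans (_ : \sum_(i in V) cost p / #|V|%:R <= _).
  by rewrite sumr_const -[leRHS]mulr_natr divfK // gt_eqF.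
rewrite -[leLHS]addr0; apply: lerD.
  by apply: ler_sum => i iV; rewrite le_min bV // mulrC lexx.
apply: sumr_ge0 => i _; rewrite le_min b0 mulr_ge0 ?invr_ge0 ?ltW //.
Qed.

Lemma affordable_of_share b p V :
  V != set0 -> V \subset supporters p -> (forall i, 0 <= b i) ->
  (forall i, i \in V -> cost p / #|V|%:R <= b i) -> affordable b p.
Proof.
move=> V0 sV b0 bV; have [r _ [cov _]] := rho_exists_le V0 sV b0 bV.
by rewrite /affordable -{1}cov; apply: ler_sum => i _; rewrite ge_min lexx.
Qed.

(** Until some voter of [V] cannot pay [cost p / #|V|], every purchase has rate at most 1/|V|. Hence
    the left side, seen as a potential of the state, never decreases for any voter of [V]; it is
    compared with the right side when the first such shortage occurs. *)
Lemma mes_run_short_voter S b T p V :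
  mes_run S b T -> (forall i, 0 <= b i) -> p \notin T ->
  V != set0 -> V \subset supporters p ->
  exists2 i, i \in V &
    b i * #|V|%:R + total_cost (approval i :&: S) <
    cost p + total_cost (approval i :&: T).
Proof.
move=> run + + V0 sV.
have v0 : (0 : R) < #|V|%:R by rewrite ltr0n card_gt0.
elim: run => {S b T} [S b stop b0 pS|S b q r T qS aff rho rmin run IH b0 pT].
  case: (pselect (exists2 i, i \in V & b i < cost p / #|V|%:R)) => [[i iV]|no].
    by exists i => //; rewrite ltrD2r -ltr_pdivlMr.
  case: (stop p pS); apply: (affordable_of_share V0 sV b0) => i iV.
  by rewrite leNgt; apply/negP => bi; apply: no; exists i.
have [sT _] := mes_run_sound (fun i => charge_ge0 q r i b0) run.
have sST : S \subset T by apply: subset_trans sT; apply: subsetUr.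
have pS : p \notin S by apply: contra pT; apply: (subsetP sST).
case: (pselect (exists2 i, i \in V & b i < cost p / #|V|%:R)) => [[i iV]|no].
  rewrite ltr_pdivlMr // => bi; exists i => //.
  by apply: ltr_leD => //; apply/total_cost_subset/setIS.
have bV i : i \in V -> cost p / #|V|%:R <= b i.
  by move=> iV; rewrite leNgt; apply/negP => bi; apply: no; exists i.
have [r' r'V rho'] := rho_exists_le V0 sV b0 bV.
(* [p] itself competes with [q], so the chosen rate is at most that of [p]. *)
have rV := le_trans (rmin _ _ pS (affordable_of_share V0 sV b0 bV) rho') r'V.
have [i iV lt] := IH (fun i => charge_ge0 q r i b0) pT.
(* The voter found after the purchase also works before it: if she approves [q], she pays at most
   [cost q / #|V|] while her approved cost grows by [cost q]. *)
exists i => //; apply: le_lt_trans lt; rewrite /charge inE.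
case: ifP => qi; last first.
  by rewrite lerD2l; apply/total_cost_subset/setIS/subsetUr.
have -> : approval i :&: (q |: S) = q |: (approval i :&: S).
  by apply/setP => x; rewrite !inE; case: eqP => // ->; rewrite qi.
rewrite {2}/total_cost big_setU1 ?inE ?(negPf qS) ?andbF //= -/(total_cost _).
have : r * cost q * #|V|%:R <= cost q.
  by rewrite mulrAC ger_pMl ?cost_gt0 // -ler_pdivlMr // div1r.
have : Num.min (b i) (r * cost q) * #|V|%:R <= r * cost q * #|V|%:R.
  by rewrite ler_pM2r // ge_min lexx orbT.
by rewrite mulrBl; lra.
Qed.

(** * Bounds on Value-Based payments *)

Lemma sum_approved_exchange V S (F : project I -> R) :
  \sum_(i in V) \sum_(q in approval i :&: S) F q =
  \sum_(q in S) F q *+ #|V :&: supporters q|.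
Proof.
rewrite (exchange_big_dep (mem S)) /=; last by move=> i q _; rewrite inE => /andP[].
apply: eq_bigr => q qS; rewrite -sumr_const.
by apply: eq_bigl => i; rewrite !inE qS andbT.
Qed.

(** Every denominator is at least the threshold, so no pre-selected project is charged at a rate
    above 1/|V|. *)
Lemma vb_payment_le_of_threshold BR S i V :
  (#|V| <= threshold BR S)%N ->
  vb_payment BR S i * #|V|%:R <= total_cost (approval i :&: S).
Proof.
move=> le; rewrite /vb_payment mulr_suml; apply: ler_sum => q _.
have m0 : (0 : R) < (maxn (value q) (threshold BR S))%:R.
  by rewrite ltr0n leq_max supporters_gt0.
rewrite mulrAC ler_pdivrMr // ler_pM2l ?cost_gt0 // ler_nat.
by apply: leq_trans le _; apply: leq_maxr.
Qed.

(** Project by project: if [q] is valued at least as much as [p], its rate is at most 1/|V|, and its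
    share goes to the last sum; otherwise [V] pays at most the full [cost q], since at most
    [value q] voters pay for it. *)
Lemma sum_vb_payment_le BR S p V :
  (#|V| <= value p)%N ->
  #|V|%:R * \sum_(i in V) vb_payment BR S i <=
  #|V|%:R * total_cost (S :\: at_least_as_valued S p) +
  \sum_(i in V) total_cost (approval i :&: S).
Proof.
move=> Vp; rewrite /vb_payment /total_cost !sum_approved_exchange.
have -> : \sum_(q in S :\: at_least_as_valued S p) cost q =
    \sum_(q in S) if (value p <= value q)%N then 0 else cost q.
  rewrite [RHS](bigID (fun q => value p <= value q)%N) /=.
  rewrite [X in _ = X + _]big1 ?add0r; last first.
    by move=> q /andP[_ ->].
  rewrite [RHS](eq_bigr (@cost R I)); last by move=> q /andP[_ /negPf ->].
  by apply: eq_bigl => q; rewrite !inE; case: (q \in S); rewrite ?andbF ?andbT.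
rewrite !mulr_sumr -big_split /=; apply: ler_sum => q qS.
set M := maxn _ _; set k := #|V :&: _|.
have c0 := cost_gt0 q.
have m0 : (0 : R) < M%:R by rewrite ltr0n leq_max supporters_gt0.
have vM : (value q <= M)%N by apply: leq_maxl.
rewrite -(mulr_natr (_ / _)) -(mulr_natr (cost q) k); case: ifP => pq.
  rewrite mulr0 add0r mulrA ler_wpM2r // mulrA ler_pdivrMr // mulrC.
  by rewrite ler_pM2l // ler_nat (leq_trans Vp) // (leq_trans pq).
apply: le_trans (_ : #|V|%:R * cost q <= _); last by rewrite lerDl mulr_ge0 // ltW.
rewrite ler_wpM2l // mulrAC ler_pdivrMr // ler_pM2l // ler_nat.
by apply: leq_trans vM; apply/subset_leq_card/subsetIr.
Qed.

Lemma lt_threshold BR S p :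
  p \notin S -> (threshold BR S < value p)%N ->
  BR < total_cost (at_least_as_valued S p) + cost p.
Proof.
move=> pS; rewrite ltnNge ltNge; apply: contra => fits.
by rewrite /threshold (bigD1 p) ?inE ?pS //= leq_maxl.
Qed.

(** * The axiom for the set returned by the Value-Based constituent rule *)

Lemma mes_value_based_ejr BR S T (a : R) :
  mes_outcome (value_based R) BR S T ->
  min_voter_budget_share (value_based R) BR S a -> ejr_plus_any a T.
Proof.
move=> [b [[b0 sb] bmax] run] [b' [fb' _] ->] V p V0.
set mb := voter_min _; rewrite in_setD => /andP[pT /bigcapP pV].
have B0 := budget_gt0 I.
have n0 : (0 : R) < (nvoters I)%:R by rewrite ltr0n nvoters_gt0.
have -> : mb * ((nvoters I)%:R / budget I) *
    (#|V|%:R * budget I / (nvoters I)%:R) = mb * #|V|%:R.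
  by field; rewrite !gt_eqF.
(* The maximizer [b'] defining the share may differ from the budgets [b] of the run; optimality of
   [b] transfers the bound. *)
have ab i : mb <= vb_payment BR S i + b i.
  by apply: le_trans (bmax _ fb') _; apply: bigmin_le.
have v0 : (0 : R) < #|V|%:R by rewrite ltr0n card_gt0.
have sV : V \subset supporters p by apply/subsetP => i /pV; rewrite inE.
have Vp : (#|V| <= value p)%N by apply: subset_leq_card.
have [sST _] := mes_run_sound b0 run.
have pS : p \notin S by apply: contra pT; apply: (subsetP sST).
case: (pselect (exists2 i, i \in V &
  mb * #|V|%:R < total_cost (approval i :&: T) + cost p)) => // no.
have viol i : i \in V -> total_cost (approval i :&: T) + cost p <= mb * #|V|%:R.
  by move=> iV; rewrite leNgt; apply/negP => lt; apply: no; exists i.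
(* Otherwise the short voter's payment and budget, scaled by |V|, stay below her violated bound
   [mb * #|V|], against [ab]. *)
have tV : (threshold BR S < #|V|)%N.
  have [i iV lt] := mes_run_short_voter run b0 pT V0 sV.
  rewrite ltnNge; apply/negP => /(@vb_payment_le_of_threshold _ _ i) pay.
  have := ab i; rewrite -(ler_pM2r v0) mulrDl.
  by have := viol i iV; lra.
have over := lt_threshold pS (leq_trans tV Vp).
have split_S : total_cost S = total_cost (at_least_as_valued S p) +
    total_cost (S :\: at_least_as_valued S p).
  rewrite /total_cost (big_setID (at_least_as_valued S p)) /=; congr (_ + _).
  by apply: eq_bigl => q; rewrite !inE; case: (q \in S).
have sum_b : \sum_(i in V) b i <= BR - total_cost S.
  move: sb; rewrite /available_share divfK ?gt_eqF // => <-.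
  by rewrite [leRHS](bigID (mem V)) /= lerDl sumr_ge0.
have sum_a : mb * #|V|%:R <= \sum_(i in V) vb_payment BR S i + (BR - total_cost S).
  apply: le_trans (lerD (lexx _) sum_b); rewrite -big_split /= mulr_natr -sumr_const.
  by apply: ler_sum.
have avg : \sum_(i in V) total_cost (approval i :&: S) + #|V|%:R * cost p <=
    #|V|%:R * (mb * #|V|%:R).
  rewrite (mulr_natl (cost p)) (mulr_natl (mb * _)).
  rewrite -(sumr_const (mem V) (cost p)) -(sumr_const (mem V) (mb * _)) -big_split /=.
  apply: ler_sum => i /viol; apply: le_trans; rewrite lerD2r.
  exact/total_cost_subset/setIS.
have pays := sum_vb_payment_le BR S Vp.
rewrite -(ler_pM2l v0) mulrDr in sum_a.
(* Let U be the projects of [S] valued at least as much as [p]. Chaining [avg], [sum_a] and [pays]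
   cancels the approved costs and leaves c(U) + c(p) at most [BR], which [over] denies. *)
move: over; rewrite -subr_gt0 -(pmulr_rgt0 _ v0).
by rewrite split_S in sum_a; lra.
Qed.

(** A larger outcome leaves fewer projects to object with and only raises approved costs. *)
Lemma ejr_plus_any_superset (a : R) S T :
  S \subset T -> ejr_plus_any a S -> ejr_plus_any a T.
Proof.
move=> sST ejr V p V0; rewrite in_setD => /andP[pT pV].
have [|i iV lt] := ejr V p V0.
  by rewrite in_setD pV andbT; apply: contra pT; apply: (subsetP sST).
exists i => //; apply: lt_le_trans lt _; rewrite lerD2r.
exact/total_cost_subset/setIS.
Qed.

End Rules.

(** * Propagation along a mixed execution *)

Lemma mixed_execution_admissible (R : realType) (m : nat)
    (Rs : 'I_m -> voting_rule R) (I : instance R) (Bs : 'I_m -> R)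
    (Ps : nat -> {set project I}) (run : mixed_execution Rs Bs Ps) (k : 'I_m) :
  admissible (Bs k) (Ps k).
Proof.
case: k => k km; elim: k km => [|k IH] km.
  split; [exact: rule_budget_gt0 run _|exact: rule_budget_le run _|].
  exact: initial_cost_le run _ _.
(* The previous rule respects its own budget, which is at most the next one. *)
split; [exact: rule_budget_gt0 run _|exact: rule_budget_le run _|].
have [_ le] := outcome_sound (IH (ltnW km)) (rule_step run (Ordinal (ltnW km))).
by apply: le_trans le _; apply: rule_budget_mono run _ _ _; rewrite /= leqnSn.
Qed.

Lemma mixed_execution_subset (R : realType) (m : nat)
    (Rs : 'I_m -> voting_rule R) (I : instance R) (Bs : 'I_m -> R)
    (Ps : nat -> {set project I}) (run : mixed_execution Rs Bs Ps) (k : nat) :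
  (k <= m)%N -> Ps k \subset Ps m.
Proof.
(* Downward induction from [m], on the distance [m - k]. *)
move=> km; rewrite -(subKn km); elim: (m - k)%N => [|j IH]; first by rewrite subn0.
(* Once [j] reaches [m], both truncated differences are 0. *)
case: (leqP m j) => jm; first by move: IH; rewrite (eqP jm) (eqP (leqW jm)).
have lt : (m - j.+1 < m)%N by rewrite ltn_subrL (leq_ltn_trans _ jm).
have [sub _] := outcome_sound (mixed_execution_admissible run (Ordinal lt))
  (rule_step run (Ordinal lt)).
by apply: subset_trans sub _; rewrite /= subnSK.
Qed.

Unset Implicit Arguments.

Theorem theorem5p2 (R : realType) (m : nat) (Rs : 'I_m -> voting_rule R)
    (I : instance R) (Bs : 'I_m -> R) (Ps : nat -> {set project I})
    (k : 'I_m) (alpha alphaVB : R)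
    (run : mixed_execution Rs Bs Ps)
    (is_mes : Rs k = mes (value_based R))
    (def_alpha : alpha = available_share (Bs k) (Ps k))
    (def_alphaVB :
       min_voter_budget_share (value_based R) (Bs k) (Ps k) alphaVB)
    (alpha_le : alpha <= alphaVB) :
  ejr_plus_any alphaVB (Ps m).
Proof.
have step := rule_step run k; rewrite is_mes in step.
(* Rule [k] outputs [Ps k.+1], which the later rules only enlarge. *)
apply: ejr_plus_any_superset (mes_value_based_ejr step def_alphaVB).
exact: (mixed_execution_subset run (ltn_ord k)).
Qed.
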